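(* Let $\lambda\in(0,1)$ and $T\in\mathbb{B}(\mathcal{H})$. Then the following conditions are equivalent: (i) $\|P_{\lambda}(T)\|=\|T\|$. (ii) $\|T\|^2\in\overline{W\Big(\big(M_{\frac{(1-\lambda)^2}{(1-\lambda)^2+\lambda^2}}(T)\big)^{*}\Delta(T)\Big)}$.
   Context: $\mathbb{B}(\mathcal{H})$ denotes the bounded linear operators on a nonzero complex Hilbert space $\mathcal{H}$. $W(S)=\{\langle Sx,x\rangle:\|x\|=1\}$ is the numerical range of $S$, and the bar denotes closure in $\mathbb{C}$. Every $T\in\mathbb{B}(\mathcal{H})$ has a unique polar decomposition $T=U|T|$, where $|T|=(T^{*}T)^{1/2}$ and $U$ is a partial isometry with $\mathcal{N}(U)=\mathcal{N}(T)$. The Duggal transform is $T^{D}=|T|U$, the Aluthge transform is $\Delta(T)=|T|^{1/2}U|T|^{1/2}$, for $t\in[0,1]$ the weighted mean transform is $M_{t}(T)=tT+(1-t)T^{D}$, and for $\lambda\in[0,1]$ the power mean transform is $P_{\lambda}(T)=(1-\lambda)^2T+\lambda^2T^{D}+2\lambda(1-\lambda)\Delta(T)$. *)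

(* Defs.v *)
From mathcomp Require Import all_boot all_order all_algebra.
From mathcomp Require Import all_classical all_reals all_analysis.
From mathcomp Require Import complex.

Set Implicit Arguments.
Unset Strict Implicit.
Unset Printing Implicit Defensive.

Import Order.TTheory GRing.Theory Num.Theory.
Import numFieldNormedType.Exports.

Local Open Scope classical_set_scope.
Local Open Scope ring_scope.
Local Open Scope complex_scope.

(* Operators are plain functions H -> H, which form a module over R[i] for the
   pointwise operations; membership in B(H) is the predicate [bounded_operator].
   The adjoint, the positive square root and the partial isometry of the polar
   decomposition are selected by [get] among the operators satisfying their
   defining property; for bounded operators on a Hilbert space (positive ones
   for the square root) exactly one such operator exists. *)
Section Operators.
Variables (R : realType) (H : completeNormedModType R[i]).
(* [ip x y] is linear in x and conjugate-linear in y *)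
Variable ip : {dot H for Num.conj}.

Definition bounded_operator (S : H -> H) : Prop :=
  linear S /\ exists M : R[i], forall x : H, `|S x| <= M * `|x|.

(* [`|y|] lies in R[i]; [complex.Re] brings it back to R *)
Definition opnorm (S : H -> H) : R :=
  sup [set complex.Re `|S x| | x in [set x : H | `|x| <= 1]].

Definition numerical_range (S : H -> H) : set R[i]^o :=
  [set ip (S x) x | x in [set x : H | `|x| = 1]].

Definition adjoint (S : H -> H) : H -> H :=
  get [set A : H -> H | bounded_operator A /\
                        forall x y, ip (S x) y = ip x (A y)].

(* [0 <= z] in R[i] means that z is real and nonnegative *)
Definition positive_operator (S : H -> H) : Prop :=
  bounded_operator S /\ forall x, 0 <= ip (S x) x.

Definition op_sqrt (S : H -> H) : H -> H :=
  get [set P : H -> H | positive_operator P /\ P \o P = S].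

Definition modulus (T : H -> H) : H -> H := op_sqrt (adjoint T \o T).

Definition nullspace (S : H -> H) : set H := [set x | S x = 0].

Definition partial_isometry (U : H -> H) : Prop :=
  bounded_operator U /\
  forall x, (forall y, nullspace U y -> ip x y = 0) -> `|U x| = `|x|.

Definition polar_part (T : H -> H) : H -> H :=
  get [set U : H -> H | [/\ partial_isometry U,
                            nullspace U = nullspace T &
                            T = U \o modulus T]].

Definition duggal (T : H -> H) : H -> H := modulus T \o polar_part T.

Definition aluthge (T : H -> H) : H -> H :=
  op_sqrt (modulus T) \o polar_part T \o op_sqrt (modulus T).

Definition mean_transform (t : R) (T : H -> H) : H -> H :=
  t%:C *: T + (1 - t)%:C *: duggal T.

Definition power_mean_transform (lam : R) (T : H -> H) : H -> H :=
  ((1 - lam) ^+ 2)%:C *: T + (lam ^+ 2)%:C *: duggal T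
  + (2 * lam * (1 - lam))%:C *: aluthge T.

End Operators.

(* Main.v *)
(* With c = (1 - lam)^2 + lam^2, the power mean transform is the convex
   combination c M + (1 - c) Delta of the weighted mean transform M and the
   Aluthge transform, both of norm at most |T|.  Expanding |Px|^2 shows that
   |Px| is close to |T| for a unit vector x exactly when Re <Delta x, M x> is
   close to |T|^2, and then Delta x - M x is small, so the imaginary part of
   <Delta x, M x> is small as well.

   The operators chosen by [get] are usable only once they are known to exist.
   Adjoints and the polar part come from a Riesz representation theorem for
   functionals that factor through a linear map A.  For square roots, rescale S
   so that A = I - S is a contraction; the iteration Y |-> (A + Y^2) / 2 from 0
   converges in norm, being dominated by y |-> (1 + y^2) / 2, and I - lim Y is
   the root. *)

Require Import Defs.
From mathcomp Require Import all_boot all_order all_algebra.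
From mathcomp Require Import all_classical all_reals all_analysis.
From mathcomp Require Import complex.
From mathcomp Require Import ring lra.

Import Order.TTheory GRing.Theory Num.Theory.
Import numFieldNormedType.Exports.

Local Open Scope classical_set_scope.
Local Open Scope ring_scope.
Local Open Scope complex_scope.

(** * The real inner product and norm underlying [ip] *)

Section RealInnerProduct.
Variables (R : realType) (H : completeNormedModType R[i]).
Variable ip : {dot H for Num.conj}.
Hypothesis norm_ip : forall x : H, `|x| ^+ 2 = ip x x.

(* Arguments are carried out in the underlying real Hilbert space; complex
   identities are recovered by replacing y with iy ([ip_eq], [reIr]). *)
Definition nr (x : H) : R := complex.Re `|x|.
Definition re (x y : H) : R := complex.Re (ip x y).

Lemma normE x : `|x| = (nr x)%:C.
Proof. by rewrite [LHS]complexE (ger0_Im (normr_ge0 x)) mulr0 addr0. Qed.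

Lemma nr_ge0 x : 0 <= nr x.
Proof. by rewrite -ler0c -normE. Qed.

Lemma nrE x : re x x = nr x ^+ 2.
Proof. by rewrite /re -norm_ip normE -rmorphXn. Qed.

Lemma reDl x y z : re (x + y) z = re x z + re y z.
Proof. by rewrite /re linearDl /=; case: (ip x z) (ip y z) => a b []. Qed.
Lemma reDr x y z : re x (y + z) = re x y + re x z.
Proof. by rewrite /re linearDr /=; case: (ip x y) (ip x z) => a b []. Qed.
Lemma reC x y : re x y = re y x.
Proof. by rewrite /re hermC /= expr0 mul1r; case: (ip y x). Qed.
Lemma reZl a x y : re (a%:C *: x) y = a * re x y.
Proof. by rewrite /re linearZl_LR /=; case: (ip x y) => u v /=; rewrite mul0r subr0. Qed.
Lemma reZr a x y : re x (a%:C *: y) = a * re x y.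
Proof. by rewrite reC reZl reC. Qed.
Lemma reIl x y : re ('i *: x) y = - complex.Im (ip x y).
Proof. by rewrite /re linearZl_LR /=; case: (ip x y) => u v /=; rewrite mul0r mul1r sub0r. Qed.
Lemma reIr x y : re x ('i *: y) = complex.Im (ip x y).
Proof. rewrite reC reIl hermC /= expr0 mul1r; case: (ip x y) => u v /=; exact: opprK. Qed.
Lemma reII x y : re ('i *: x) ('i *: y) = re x y.
Proof.
rewrite reIl linearZr_LR /re /=; case: (ip x y) => u v /=.
by rewrite mul0r add0r mulNr opprK mul1r.
Qed.
Lemma reNl x y : re (- x) y = - re x y.
Proof. by rewrite /re linearNl /=; case: (ip x y). Qed.
Lemma reNr x y : re x (- y) = - re x y.
Proof. by rewrite reC reNl reC. Qed.
Lemma reBl x y z : re (x - y) z = re x z - re y z.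
Proof. by rewrite reDl reNl. Qed.
Lemma reBr x y z : re x (y - z) = re x y - re x z.
Proof. by rewrite reDr reNr. Qed.
Lemma re0l x : re 0 x = 0.
Proof. by rewrite /re linear0l. Qed.

Definition reE := (reDl, reDr, reBl, reBr, reNl, reNr, reZl, reZr, re0l).

Lemma nr0 : nr 0 = 0. Proof. by rewrite /nr normr0. Qed.
Lemma nr_eq0 x : nr x = 0 -> x = 0.
Proof. by move=> h; apply/normr0_eq0; rewrite normE h. Qed.
Lemma nrN x : nr (- x) = nr x. Proof. by rewrite /nr normrN. Qed.
Lemma nrB x y : nr (x - y) = nr (y - x). Proof. by rewrite /nr distrC. Qed.
Lemma nrD x y : nr (x + y) <= nr x + nr y.
Proof. by rewrite -lecR rmorphD /= -!normE ler_normD. Qed.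
Lemma nrZ a x : nr (a%:C *: x) = `|a| * nr x.
Proof.
have: `|a%:C *: x| = `|a%:C| * `|x| := normrZ _ _.
rewrite !normE normc_def /= expr0n addr0 sqrtr_sqr -rmorphM /=.
by move/complexI.
Qed.
Lemma nrI x : nr ('i *: x) = nr x.
Proof. by apply/eqP; rewrite -(eqrXn2 (n:=2)) ?nr_ge0 // -!nrE reII. Qed.

Lemma re_inj x y : (forall z, re z x = re z y) -> x = y.
Proof.
move=> h; apply/subr0_eq/nr_eq0/eqP; rewrite -sqrf_eq0 -nrE reBr h subrr //.
Qed.

Lemma ip_eq x y x' y' :
  re x y = re x' y' -> re x ('i *: y) = re x' ('i *: y') -> ip x y = ip x' y'.
Proof.
rewrite !reIr /re; case: (ip x y) (ip x' y') => a b [c d] /=; by move=> -> ->.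
Qed.

Lemma re_cs x y : re x y <= nr x * nr y.
Proof.
have [/nr_eq0 ->|x0] := eqVneq (nr x) 0; first by rewrite nr0 mul0r re0l.
have [/nr_eq0 ->|y0] := eqVneq (nr y) 0; first by rewrite reC nr0 mulr0 re0l.
have xy0 : 0 < nr x * nr y by rewrite mulr_gt0 // lt0r ?x0 ?y0 nr_ge0.
rewrite -(ler_pM2l xy0).
(* Expanding this square gives Cauchy-Schwarz multiplied by 2 |x| |y|. *)
have := sqr_ge0 (nr ((nr y)%:C *: x - (nr x)%:C *: y)).
rewrite -nrE !reE (reC y x) !nrE; nra.
Qed.

(** Completeness of [H] enters only in this form, with real radii in place of the complex radii of
    the normed module. *)
Lemma hilbert_complete (u : nat -> H) :
  (forall e : R, 0 < e ->
    exists N, forall n m, (N <= n)%N -> (N <= m)%N -> nr (u n - u m) < e) ->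
  exists l, forall e : R, 0 < e -> exists N, forall n, (N <= n)%N -> nr (u n - l) < e.
Proof.
move=> h.
have /cauchy_cvg cu : cauchy (u @ \oo).
  apply/cauchy_exP => e e0.
  have ee : e = (complex.Re e)%:C by rewrite {1}[e]complexE (ger0_Im (ltW e0)) mulr0 addr0.
  have [|N hN] := h (complex.Re e); first by rewrite -ltcR -ee.
  exists (u N); exists N => // n /= Nn.
  by rewrite -ball_normE /ball_ /= normE ee ltcR hN.
exists (lim (u @ \oo)) => e e0.
have /cvg_ball := cu => /(_ e%:C); rewrite ltcR => /(_ e0) [N _ hN].
exists N => n Nn; have := hN n Nn; rewrite -ball_normE /ball_ /= normE ltcR nrB //.
Qed.

(** * Linear and bounded operators *)

Lemma linear_D {S : H -> H} : linear S -> {morph S : x y / x + y}.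
Proof. by move=> h x y; have := h 1 x y; rewrite !scale1r. Qed.
Lemma linear_0 {S : H -> H} : linear S -> S 0 = 0.
Proof. by move=> h; apply: (addIr (S 0)); rewrite -linear_D // !add0r. Qed.
Lemma linear_Z {S : H -> H} : linear S -> forall a x, S (a *: x) = a *: S x.
Proof. by move=> h a x; have := h a x 0; rewrite !(linear_0 h) !addr0. Qed.
Lemma linear_B {S : H -> H} : linear S -> {morph S : x y / x - y}.
Proof.
move=> h x y /=; have := linear_D h (x - y) y.
by rewrite subrK => ->; rewrite addrK.
Qed.
Lemma linear_comp {S T : H -> H} : linear S -> linear T -> linear (S \o T).
Proof. by move=> hS hT a x y /=; rewrite hT hS. Qed.

Lemma bounded_operatorP (S : H -> H) :
  bounded_operator S <->
  linear S /\ exists2 m : R, 0 < m & forall x, nr (S x) <= m * nr x.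
Proof.
split=> -[lS [M]].
  (* The order of [R[i]] compares real parts, so [a] alone is already a bound; [|a| + 1] is moreover
     positive. *)
  case: M => a b hM; split=> //; exists (`|a| + 1) => [|x].
    by have := normr_ge0 a; lra.
  have := hM x; rewrite !normE lecE => /andP[_ /=]; rewrite mulr0 subr0.
  move=> /le_trans; apply; apply: ler_wpM2r; first exact: nr_ge0.
  by have := ler_norm a; lra.
by move=> m0 hM; split=> //; exists M%:C => x; rewrite !normE -rmorphM /= lecR.
Qed.

Lemma bounded_comp {S T : H -> H} :
  bounded_operator S -> bounded_operator T -> bounded_operator (S \o T).
Proof.
move=> /bounded_operatorP[lS [m m0 hm]] /bounded_operatorP[lT [k k0 hk]].
apply/bounded_operatorP; split; first exact: linear_comp.
exists (m * k) => [|x]; first exact: mulr_gt0.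
by apply: (le_trans (hm _)); rewrite -mulrA ler_pM2l.
Qed.

Lemma bounded_scaleD {S T : H -> H} (a b : R) :
  bounded_operator S -> bounded_operator T -> bounded_operator (a%:C *: S + b%:C *: T).
Proof.
move=> /bounded_operatorP[lS [m m0 hm]] /bounded_operatorP[lT [k k0 hk]].
apply/bounded_operatorP; split.
  move=> c x y; rewrite !fctE /= lS lT !scalerDr !scalerA.
  by rewrite ![_ * c]mulrC addrACA.
exists (`|a| * m + `|b| * k + 1) => [|x].
  by rewrite ltr_wpDl // addr_ge0 // mulr_ge0 // ltW.
rewrite !fctE /=; apply: (le_trans (nrD _ _)); rewrite !nrZ.
have := hm x; have := hk x; have := nr_ge0 x.
have := normr_ge0 a; have := normr_ge0 b; nra.
Qed.

(** Limits e -> 0 are taken through this lemma: if a > 0, then e = a / (|C| + 1) gives a < a,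
    whatever the sign of C. *)
Lemma le0_of_le_eps (a C : R) : (forall e, 0 < e -> a <= e * C) -> a <= 0.
Proof.
move=> h; rewrite leNgt; apply/negP => a0.
have C0 : 0 < `|C| + 1 by have := normr_ge0 C; lra.
have := h (a / (`|C| + 1)); rewrite divr_gt0 // => /(_ isT).
rewrite -mulrA -ler_pdivrMl // mulVf ?gt_eqF // ler_pdivlMl // mulr1.
by have := ler_norm C; lra.
Qed.

Lemma natSinv_lt_near (e : R) : 0 < e -> exists N, forall n, (N <= n)%N -> n.+1%:R^-1 < e.
Proof. by move=> e0; have [N _ hN] := near_infty_natSinv_lt (PosNum e0); exists N. Qed.

(** * Riesz representation through a linear map *)

Definition range_closure (A : H -> H) : set H :=
  [set v | forall e : R, 0 < e -> exists z, nr (v - A z) < e].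

Lemma range_closure_range A z : range_closure A (A z).
Proof. by move=> e e0; exists z; rewrite subrr nr0. Qed.

(* Minimise |Az|^2 - 2 f(z): a minimising sequence has Az Cauchy by the
   parallelogram law, and the first variation at the limit gives the identity. *)
Lemma riesz_range (A : H -> H) (f : H -> R) (M : R) :
  linear A -> {morph f : x y / x + y} -> (forall (a : R) x, f (a%:C *: x) = a * f x) ->
  (forall x, f x <= M * nr (A x)) ->
  exists2 v, range_closure A v & forall x, f x = re (A x) v.
Proof.
move=> lA fD fZ fM.
pose phi z := re (A z) (A z) - 2 * f z.
pose m := inf (range phi).
have lb : has_lbound (range phi).
  (* [phi z] is at least |Az|^2 - 2 M |Az|, hence at least - M^2. *)
  exists (- M ^+ 2) => _ [z _ <-]; rewrite /phi nrE.
  have := fM z; have := sqr_ge0 (nr (A z) - M); nra.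
have hm z : m <= phi z by apply: ge_inf => //; exists z.
have [u hu] : {u : nat -> H & forall n, phi (u n) < m + n.+1%:R^-1}.
  apply: (@choice _ _ (fun n x => phi x < m + n.+1%:R^-1)) => n.
  have n0 : 0 < n.+1%:R^-1 :> R by rewrite invr_gt0 ltr0n.
  have [|_ [z _ <-] hz] := @inf_adherent R (range phi) _ n0; last by exists z.
  by split=> //; exists (phi 0); exists 0.
(* [phi] is at least [m] at the midpoint of [u n] and [u k], and close to [m] at both ends. *)
have mid n k : nr (A (u n) - A (u k)) ^+ 2 <= 2 * n.+1%:R^-1 + 2 * k.+1%:R^-1.
  have := hm ((2^-1)%:C *: (u n + u k)).
  rewrite -nrE /phi !(linear_Z lA, linear_D lA) fZ fD !reE.
  have := hu n; have := hu k; rewrite /phi (reC (A (u k)) (A (u n))).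
  by move: (n.+1%:R^-1) (k.+1%:R^-1) => a b; lra.
have [|v hv] := hilbert_complete (A \o u).
  move=> e e0; have [|N hN] := natSinv_lt_near (e ^+ 2 / 4).
    by rewrite divr_gt0 // exprn_gt0.
  exists N => n k Nn Nk /=; rewrite -(@ltr_pXn2r _ 2) ?nnegrE ?nr_ge0 ?(ltW e0) //.
  apply: (le_lt_trans (mid n k)); move: (hN _ Nn) (hN _ Nk).
  by move: (n.+1%:R^-1) (k.+1%:R^-1) (e ^+ 2) => a b c; lra.
exists v => [e e0|x].
  by have [N hN] := hv _ e0; exists (u N); rewrite nrB; apply: hN.
set d := f x - re (A x) v; suff : d ^+ 2 <= 0.
  by rewrite le_eqVlt ltNge sqr_ge0 orbF sqrf_eq0 /d subr_eq0 => /eqP.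
set q := re (A x) (A x).
have q0 : 0 <= q by rewrite /q nrE sqr_ge0.
(* Compare [phi (u n + t x)] with [m], then replace [A (u n)] by its limit [v] at a cost
   proportional to e. *)
have variation t e : 0 < e -> 2 * t * d - t ^+ 2 * q <= e * (1 + 2 * `|t| * nr (A x)).
  move=> e0; have [N1 h1] := natSinv_lt_near e e0; have [N2 h2] := hv _ e0.
  set n := maxn N1 N2.
  have {}h1 := h1 n (leq_maxl _ _); have {}h2 : nr (A (u n) - v) < e := h2 n (leq_maxr _ _).
  have := hm (u n + t%:C *: x); have := hu n.
  rewrite /phi !(linear_D lA, linear_Z lA) fD fZ !reE -/q (reC (A x) (A (u n))).
  have : t * re (A (u n) - v) (A x) <= `|t| * nr (A x) * e.
    rewrite -reZl; apply: (le_trans (re_cs _ _)); rewrite nrZ.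
    by have := ler_wpM2l (mulr_ge0 (normr_ge0 t) (nr_ge0 (A x))) (ltW h2); lra.
  rewrite reBl (reC (A (u n)) (A x)) /d (reC v).
  move: h1; move: (n.+1%:R^-1) => a; nra.
(* The best t would be d / q; the denominator q + 1 also covers A x = 0. *)
have := le0_of_le_eps _ _ (variation (d / (q + 1))).
have q1 : 0 < q + 1 by lra.
have -> : 2 * (d / (q + 1)) * d - (d / (q + 1)) ^+ 2 * q = d ^+ 2 * (q + 2) / (q + 1) ^+ 2.
  by field; rewrite gt_eqF.
rewrite pmulr_lle0 ?invr_gt0 ?exprn_gt0 // pmulr_lle0 //; lra.
Qed.

Lemma re_conj (a : R[i]) x y : re x (a *: y) = re (conjc a *: x) y.
Proof.
rewrite /re linearZ_LR linearZl_LR /=.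
by case: a (ip x y) => p q [s t] /=.
Qed.

Lemma nr_scale (a : R[i]) x : nr (a *: x) = complex.Re `|a| * nr x.
Proof. by rewrite {1}/nr normrZ normE normc_def /= mulr0 subr0. Qed.

Lemma range_closure_orth A v w :
  range_closure A v -> (forall z, re (A z) w = 0) -> re v w = 0.
Proof.
move=> clv h; apply/eqP; rewrite eq_le; apply/andP; split.
  apply: (@le0_of_le_eps _ (nr w)) => e e0; have [z hz] := clv _ e0.
  rewrite -[re v w]subr0 -(h z) -reBl; apply: (le_trans (re_cs _ _)).
  by rewrite ler_wpM2r ?nr_ge0 // ltW.
rewrite -oppr_le0; apply: (@le0_of_le_eps _ (nr w)) => e e0; have [z hz] := clv _ e0.
rewrite -[re v w]subr0 -(h z) -reBl -reNl; apply: (le_trans (re_cs _ _)).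
by rewrite nrN ler_wpM2r ?nr_ge0 // ltW.
Qed.

Lemma range_closure_linear A (a : R[i]) v w : linear A ->
  range_closure A v -> range_closure A w -> range_closure A (a *: v + w).
Proof.
move=> lA clv clw e e0.
have a0 : 0 <= complex.Re `|a| by have := normr_ge0 a; rewrite lecE => /andP[].
have [|z hz] := clv (e / (2 * (complex.Re `|a| + 1))); first by rewrite divr_gt0 //; lra.
have [|z' hz'] := clw (e / 2); first by lra.
exists (a *: z + z'); rewrite lA opprD addrACA -scalerBr.
apply: (le_lt_trans (nrD _ _)); rewrite nr_scale.
have : complex.Re `|a| * nr (v - A z) <= e / 2; last by lra.
have := ltW hz; rewrite ler_pdivlMr ?mulr_gt0 //; last by lra.
by have := nr_ge0 (v - A z); nra.
Qed.

(** * Adjoints of bounded operators *)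

Lemma nr_le_of_sqr x (c : R) : 0 <= c -> nr x ^+ 2 <= nr x * c -> nr x <= c.
Proof.
move=> c0; have [->//|x0] := eqVneq (nr x) 0.
by rewrite expr2 ler_pM2l // lt0r x0 nr_ge0.
Qed.

(** Since [re] separates vectors, testing against every z forces A to be linear; putting x = A y in
    the identity bounds |A y|. *)
Lemma re_adjoint_bounded (S A : H -> H) : bounded_operator S ->
  (forall x y, re (S x) y = re x (A y)) ->
  bounded_operator A /\ forall x y, ip (S x) y = ip x (A y).
Proof.
move=> /bounded_operatorP[lS [m m0 hm]] h.
have lA : linear A.
  move=> a x y; apply: re_inj => z.
  by rewrite -h !reDr !re_conj -(linear_Z lS) !h.
split=> [|x y]; last by apply: ip_eq; rewrite h ?(linear_Z lA).
apply/bounded_operatorP; split=> //; exists m => // x.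
apply: nr_le_of_sqr; first by rewrite mulr_ge0 ?nr_ge0 ?ltW.
rewrite -nrE -h; apply: (le_trans (re_cs _ _)).
by rewrite mulrA [nr _ * m]mulrC; apply: ler_wpM2r; [exact: nr_ge0 | exact: hm].
Qed.

(** [riesz_range] for the identity map represents x |-> [re (S x) y]. One witness suffices: [get]
    then returns an operator with the defining property. *)
Lemma adjointP (S : H -> H) : bounded_operator S ->
  bounded_operator (adjoint ip S) /\ forall x y, ip (S x) y = ip x (adjoint ip S y).
Proof.
move=> bS; suff /getPex : exists A, [set A | bounded_operator A /\
  forall x y, ip (S x) y = ip x (A y)] A by [].
move/bounded_operatorP: (bS) => [lS [m m0 hm]].
have [A hA] : {A : H -> H & forall y x, re (S x) y = re x (A y)}.
  apply: (@choice _ _ (fun y v => forall x, re (S x) y = re x v)) => y.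
  have [|||x|v _ hv] := @riesz_range id (fun x => re (S x) y) (m * nr y); last by exists v.
  - by [].
  - by move=> x z; rewrite (linear_D lS) reDl.
  - by move=> a x; rewrite (linear_Z lS) reZl.
  apply: (le_trans (re_cs _ _)); rewrite [leRHS]mulrAC.
  by apply: ler_wpM2r; [exact: nr_ge0 | exact: hm].
by exists A; apply: re_adjoint_bounded.
Qed.

Lemma re_adjoint (S : H -> H) x y : bounded_operator S ->
  re (S x) y = re x (adjoint ip S y).
Proof. by move=> /adjointP[_ h]; rewrite /re h. Qed.

(** * Positive operators *)

(** Positivity makes <Pz, z> real for every z; taking z = x + iy polarises this into symmetry. *)
Lemma positive_re_sym {P : H -> H} x y : positive_operator ip P ->
  re (P x) y = re x (P y).
Proof.
move=> [[lP _] pP].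
have im z : re (P z) ('i *: z) = 0 by rewrite reIr (ger0_Im (pP z)).
have := im (x + 'i *: y); have := im x; have := im y.
rewrite (linear_D lP) (linear_Z lP) scalerDr !reE !reII.
rewrite scalerA -expr2 sqr_i scaleN1r !reE (reC x).
lra.
Qed.

(** Symmetry at the pair x, ix gives Im <Px, x> = - Im <Px, x>, so <Px, x> is real. *)
Lemma positive_operator_re (P : H -> H) : bounded_operator P ->
  (forall x y, re (P x) y = re x (P y)) -> (forall x, 0 <= re (P x) x) ->
  positive_operator ip P.
Proof.
move=> bP sP pP; split=> // x; have [lP _] := bP.
have := pP x; have : re (P x) ('i *: x) = 0; last first.
  by rewrite reIr /re lecE /= => -> ->; rewrite eqxx.
by have := sP x ('i *: x); rewrite (linear_Z lP) (reC x) reIl !reIr; lra.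
Qed.

(** * The iteration behind square roots *)

(** The scalar case of [sqrt_iter], with A replaced by its norm bound 1. *)
Fixpoint majorant n : R := if n is k.+1 then (1 + majorant k ^+ 2) / 2 else 0.

Lemma majorant_bounds n : 0 <= majorant n <= majorant n.+1 /\ majorant n <= 1.
Proof.
elim: n => [|n [/andP[h0 h1] h2]] /=; first by split; [apply/andP; split|]; lra.
split; last by nra.
move: h1 => /=; set y := majorant n in h0 h2 *.
set z := (1 + y ^+ 2) / 2 => h1; apply/andP; split; first by lra.
by rewrite {1}/z; nra.
Qed.

Lemma majorant_le n m : (n <= m)%N -> majorant n <= majorant m.
Proof.
move=> /subnK <-; elim: (m - n)%N => // k ih.
by apply: (le_trans ih); have [/andP[]] := majorant_bounds (k + n).
Qed.

Lemma majorant_cvg : exists2 L, L <= 1 /\ (forall n, majorant n <= L) &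
  forall e, 0 < e -> exists n, L - majorant n < e.
Proof.
have hs : has_sup (range majorant).
  split; first by exists (majorant 0); exists 0%N.
  by exists 1 => _ [n _ <-]; have [] := majorant_bounds n.
exists (sup (range majorant)); first split.
- apply: ge_sup; first by case: hs.
  by move=> _ [n _ <-]; have [] := majorant_bounds n.
- by move=> n; apply: ub_le_sup; [case: hs | exists n].
by move=> e e0; have [_ [n _ <-] hn] := sup_adherent e0 hs; exists n; lra.
Qed.

(** A fixed point B satisfies 2B = A + B^2, that is, (I - B)^2 = I - A. *)
Fixpoint sqrt_iter (A : H -> H) n : H -> H :=
  if n is k.+1 then fun x => (2^-1)%:C *: (A x + sqrt_iter A k (sqrt_iter A k x))
  else fun=> 0.

Section SqrtIter.
Variable A : H -> H.
Hypotheses (lA : linear A) (sA : forall x y, re (A x) y = re x (A y)).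
Hypothesis cA : forall x, nr (A x) <= nr x.
Local Notation Y := (sqrt_iter A).

Lemma sqrt_iter_linear n : linear (Y n).
Proof.
elim: n => [|n ih] a x y /=; first by rewrite scaler0 addr0.
rewrite lA !ih [a *: (_ *: _)]scalerA [a * _]mulrC -[in RHS]scalerA -scalerDr.
by congr (_ *: _); rewrite scalerDr addrACA.
Qed.

Lemma sqrt_iter_sym n x y : re (Y n x) y = re x (Y n y).
Proof.
elim: n x y => [|n ih] x y /=; first by rewrite (reC x) !re0l.
by rewrite !reE sA !ih.
Qed.

Lemma sqrt_iter_norm n x : nr (Y n x) <= majorant n * nr x.
Proof.
elim: n x => [|n ih] x; first by rewrite /= nr0 mul0r.
rewrite /= nrZ ger0_norm ?invr_ge0 //.
have := nrD (A x) (Y n (Y n x)); have := cA x; have := ih (Y n x).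
by have := ih x; have [/andP[y0 _] _] := majorant_bounds n; nra.
Qed.

(* As [Y_n^2 - Y_{n-1}^2 = Y_n (Y_n - Y_{n-1}) + (Y_n - Y_{n-1}) Y_{n-1}], the
   increments of the operator iteration are dominated by the scalar ones. *)
Lemma sqrt_iter_step n x :
  nr (Y n.+1 x - Y n x) <= (majorant n.+1 - majorant n) * nr x.
Proof.
elim: n x => [|n ih] x.
  rewrite /= !subr0 addr0 nrZ ger0_norm ?invr_ge0 //.
  by have := cA x; rewrite expr0n /=; lra.
have -> : Y n.+2 x - Y n.+1 x =
    (2^-1)%:C *: (Y n.+1 (Y n.+1 x - Y n x) + (Y n.+1 (Y n x) - Y n (Y n x))).
  rewrite (linear_B (sqrt_iter_linear n.+1)) subrKA -/(Y n.+1).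
  rewrite {1}[Y n.+2]/= -/(Y n.+1) [in X in _ - X]/=.
  by rewrite -scalerBr opprD addrACA subrr add0r.
rewrite nrZ ger0_norm ?invr_ge0 //.
have := nrD (Y n.+1 (Y n.+1 x - Y n x)) (Y n.+1 (Y n x) - Y n (Y n x)).
have := sqrt_iter_norm n.+1 (Y n.+1 x - Y n x).
have := ih x; have := ih (Y n x); have := sqrt_iter_norm n x.
have [/andP[y0 y1] _] := majorant_bounds n.
have -> : majorant n.+2 = (1 + majorant n.+1 ^+ 2) / 2 by [].
have e : majorant n.+1 = (1 + majorant n ^+ 2) / 2 by [].
move: (majorant n) (majorant n.+1) e y0 y1 => y z e y0 y1.
set a := nr (Y n x); set b := nr (Y n.+1 x - Y n x).
set c := nr (Y n.+1 (Y n.+1 x - Y n x)); set d := nr (Y n.+1 (Y n x) - _).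
move=> ha hd hb hc hcd.
have : (z - y) * a <= (z - y) * (y * nr x) by apply: ler_wpM2l => //; lra.
have : z * b <= z * ((z - y) * nr x) by apply: ler_wpM2l => //; lra.
(* By [e] the left factor is (z^2 - y^2) / 2, which factors as the operator increment does. *)
have -> : ((1 + z ^+ 2) / 2 - z) * nr x = (z * ((z - y) * nr x) + (z - y) * (y * nr x)) / 2.
  by rewrite {2}e; field.
lra.
Qed.

Lemma sqrt_iter_cauchy n m x : (n <= m)%N ->
  nr (Y m x - Y n x) <= (majorant m - majorant n) * nr x.
Proof.
move=> /subnK <-; elim: (m - n)%N => [|k ih]; first by rewrite !subrr nr0 mul0r.
have -> : Y (k.+1 + n)%N x - Y n x =
  (Y (k + n).+1 x - Y (k + n)%N x) + (Y (k + n)%N x - Y n x) by rewrite subrKA.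
apply: (le_trans (nrD _ _)); have := sqrt_iter_step (k + n) x; move: ih.
by rewrite addSn; lra.
Qed.

(** B is the pointwise limit of the iterates. The rate [dist] is uniform in x up to |x|, so each
    property follows by writing its defect through differences B - Y n and letting n grow. *)
Lemma sqrt_iter_limit : exists B : H -> H, [/\ linear B,
  forall x y, re (B x) y = re x (B y), forall x, nr (B x) <= nr x &
  forall x, B x = (2^-1)%:C *: (A x + B (B x))].
Proof.
have [L [L1 yL] cvgL] := majorant_cvg.
have [B hB] : {B : H -> H & forall x, forall e, 0 < e ->
    exists N, forall n, (N <= n)%N -> nr (Y n x - B x) < e}.
  apply: (@choice _ _ (fun x l => forall e, 0 < e ->
    exists N, forall n, (N <= n)%N -> nr (Y n x - l) < e)) => x.
  apply: hilbert_complete => e e0.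
  have x1 : 0 < nr x + 1 by have := nr_ge0 x; lra.
  have [N hN] := cvgL (e / (nr x + 1)) (divr_gt0 e0 x1).
  suff close n m : (N <= n)%N -> (n <= m)%N -> nr (Y m x - Y n x) < e.
    exists N => n m Nn Nm; case: (leqP n m) => [/close|/ltnW /close]; last exact.
    by rewrite nrB; apply.
  move=> Nn nm; apply: (le_lt_trans (sqrt_iter_cauchy _ _ x nm)).
  move: hN; rewrite ltr_pdivlMr // => hN.
  have := yL m; have := majorant_le _ _ Nn; have := nr_ge0 x.
  by have := yL n; move: hN; nra.
have dist n x : nr (B x - Y n x) <= (L - majorant n) * nr x.
  rewrite -subr_le0; apply: (@le0_of_le_eps _ 1) => e e0.
  have [N hN] := hB x _ e0; have /ltW := hN _ (leq_maxl N n).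
  have := sqrt_iter_cauchy _ _ x (leq_maxr N n).
  have := nrD (B x - Y (maxn N n) x) (Y (maxn N n) x - Y n x).
  rewrite subrKA (nrB (B x) (Y (maxn N n) x)).
  have := ler_wpM2r (nr_ge0 x) (yL (maxn N n)); lra.
have tends0 (a C : R) : (forall n, a <= (L - majorant n) * C) -> 0 <= C -> a <= 0.
  move=> h C0; apply: (@le0_of_le_eps _ C) => e e0.
  by have [n /ltW hn] := cvgL _ e0; apply: (le_trans (h n)); apply: ler_wpM2r.
have norm_tends0 z (C : R) :
    (forall n, nr z <= (L - majorant n) * C) -> 0 <= C -> z = 0.
  by move=> h C0; apply: nr_eq0; apply/eqP; rewrite eq_le nr_ge0 (tends0 _ _ h C0).
(* Apply [dist] at n = 0, where the iterate and the majorant vanish, with L <= 1. *)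
have cB x : nr (B x) <= nr x.
  have := nrD (B x - Y 0 x) (Y 0 x); rewrite subrK /= nr0 addr0.
  by have := dist 0%N x; rewrite /= subr0; have := nr_ge0 x; nra.
exists B; split=> //.
- move=> a x y; apply/subr0_eq.
  have a0 : 0 <= complex.Re `|a| by have := normr_ge0 a; rewrite lecE => /andP[].
  apply: (@norm_tends0 _ (nr (a *: x + y) + complex.Re `|a| * nr x + nr y)) => [n|].
    have -> : B (a *: x + y) - (a *: B x + B y) = (B (a *: x + y) - Y n (a *: x + y))
        + (a *: (Y n x - B x) + (Y n y - B y)).
      by rewrite sqrt_iter_linear scalerBr [X in _ = _ + X]addrACA -opprD subrKA.
    have := nrD (B (a *: x + y) - Y n (a *: x + y)) (a *: (Y n x - B x) + (Y n y - B y)).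
    have := nrD (a *: (Y n x - B x)) (Y n y - B y).
    rewrite nr_scale (nrB (Y n x)) (nrB (Y n y)).
    have := ler_wpM2l a0 (dist n x); have := dist n y; have := dist n (a *: x + y); lra.
  by rewrite !addr_ge0 ?mulr_ge0 ?nr_ge0.
- have half x y : re (B x) y <= re x (B y).
    rewrite -subr_le0; apply: (@tends0 _ (2 * (nr x * nr y))) => [n|]; last first.
      by rewrite !mulr_ge0 ?nr_ge0.
    have := re_cs (B x - Y n x) y; have := re_cs x (Y n y - B y).
    rewrite !reE sqrt_iter_sym (nrB (Y n y)).
    have := ler_wpM2l (nr_ge0 x) (dist n y); have := ler_wpM2r (nr_ge0 y) (dist n x); lra.
  by move=> x y; apply/eqP; rewrite eq_le half reC (reC (B x)) half.
move=> x; apply/subr0_eq; apply: (@norm_tends0 _ (2 * nr x)) => [n|]; last first.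
  by rewrite mulr_ge0 ?nr_ge0.
(* Y_n^2 - B^2 is split as Y_n (Y_n - B) + (Y_n - B) B, so that [dist] applies to each term. *)
have -> : B x - (2^-1)%:C *: (A x + B (B x)) = (B x - Y n.+1 x)
    + (2^-1)%:C *: (Y n (Y n x - B x) + (Y n (B x) - B (B x))).
  rewrite (linear_B (sqrt_iter_linear n)) subrKA /=.
  rewrite -[Y n _ - B (B x)](addrKA (A x)) [Y n _ + A x]addrC scalerBr.
  by rewrite subrKA.
apply: (le_trans (nrD _ _)); rewrite nrZ ger0_norm ?invr_ge0 //.
have := nrD (Y n (Y n x - B x)) (Y n (B x) - B (B x)).
have := sqrt_iter_norm n (Y n x - B x); have := dist n.+1 x; have := dist n (B x).
have := dist n x; rewrite (nrB (B x)) (nrB (B (B x))).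
have := cB x; have := nr_ge0 x; have := nr_ge0 (Y n x - B x).
have [/andP[y0 y1] y2] := majorant_bounds n; have := yL n; nra.
Qed.
End SqrtIter.

(** * Existence of positive square roots *)

(** Positivity at x - Sx / m gives 0 <= <Sx, x> - (2/m) |Sx|^2 + <SSx, Sx> / m^2, and the last term
    is at most |Sx|^2 / m. The bound makes I - S/m a contraction in [op_sqrtP]. *)
Lemma positive_sqr_le (S : H -> H) (m : R) x : positive_operator ip S -> 0 < m ->
  (forall x, nr (S x) <= m * nr x) -> nr (S x) ^+ 2 <= m * re (S x) x.
Proof.
move=> pS m0 hm; have [[lS _] _] := pS.
have : 0 <= re (S (x - (m^-1)%:C *: S x)) (x - (m^-1)%:C *: S x).
  by have [_ /(_ (x - (m^-1)%:C *: S x))] := pS; rewrite lecE => /andP[].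
rewrite (linear_B lS) (linear_Z lS) !reE (positive_re_sym (S x) x pS) -!nrE.
have := re_cs (S (S x)) (S x).
have := ler_wpM2r (nr_ge0 (S x)) (hm (S x)).
rewrite -mulrA -expr2 -nrE; set a := re (S x) (S x); set b := re (S x) x.
set c := re (S (S x)) (S x) => h1 h2 h3.
have hc : m^-1 * c <= a by rewrite ler_pdivrMl //; lra.
have h4 : m^-1 * (m^-1 * c) <= m^-1 * a by rewrite ler_wpM2l // invr_ge0 ltW.
have : m^-1 * a <= b by move: h3 h4; rewrite /b; lra.
by rewrite ler_pdivrMl.
Qed.

Lemma op_sqrtP (S : H -> H) : positive_operator ip S ->
  positive_operator ip (op_sqrt ip S) /\ op_sqrt ip S \o op_sqrt ip S = S.
Proof.
move=> pS; suff /getPex : exists P, [set P : H -> H | positive_operator ip P /\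
  P \o P = S] P by [].
have [/bounded_operatorP[lS [m m0 hm]] _] := pS.
pose A x := x - (m^-1)%:C *: S x.
have lA : linear A.
  by move=> a x y; rewrite /A lS scalerDr scalerBr !scalerA [_ * a]mulrC opprD addrACA.
have sA x y : re (A x) y = re x (A y) by rewrite /A !reE (positive_re_sym _ _ pS).
have cA x : nr (A x) <= nr x.
  rewrite -(@ler_pXn2r _ 2) ?nnegrE ?nr_ge0 // -!nrE /A !reE (reC x (S x)) !nrE.
  have := positive_sqr_le _ _ x pS m0 hm; rewrite -ler_pdivrMl // => h.
  have := ler_wpM2l (ltW (_ : 0 < m^-1)) h; rewrite invr_gt0 => /(_ m0).
  have : 0 <= m^-1 * nr (S x) ^+ 2 by rewrite mulr_ge0 ?sqr_ge0 // invr_ge0 ltW.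
  have : 0 <= m^-1 by rewrite invr_ge0 ltW.
  move: h; set b := re (S x) x; set a := nr (S x); move: (m^-1) => k; nra.
have [B [lB sB cB fB]] := sqrt_iter_limit A lA sA cA.
(* P^2 = m (I - B)^2 = m (I - A) = S. *)
pose P x := (Num.sqrt m)%:C *: (x - B x).
have lP : linear P.
  by move=> a x y; rewrite /P lB opprD addrACA -scalerBr scalerDr !scalerA [_ * a]mulrC.
have bP : bounded_operator P.
  apply/bounded_operatorP; split=> //; exists (Num.sqrt m * 2) => [|x].
    by rewrite mulr_gt0 ?sqrtr_gt0.
  rewrite /P nrZ ger0_norm ?sqrtr_ge0 // -mulrA ler_wpM2l ?sqrtr_ge0 //.
  by have := nrD x (- B x); rewrite nrN; have := cB x; lra.
exists P; split.
  apply: positive_operator_re => // [x y|x]; first by rewrite /P !reE sB.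
  rewrite /P !reE mulr_ge0 ?sqrtr_ge0 // nrE.
  by have := re_cs (B x) x; have := ler_wpM2r (nr_ge0 x) (cB x); lra.
apply/funext => x /=; rewrite /P (linear_Z lB) -scalerBr scalerA -rmorphM.
rewrite -expr2 sqr_sqrtr ?ltW //.
have -> : x - B x - B (x - B x) = (m^-1)%:C *: S x.
  have e : 2%:C *: B x = A x + B (B x).
    by rewrite {1}fB scalerA -rmorphM divff ?scale1r ?pnatr_eq0.
  rewrite (linear_B lB) opprB addrAC addrA.
  have -> : x + B (B x) - B x - B x = (A x + B (B x) - 2%:C *: B x) + (m^-1)%:C *: S x.
    rewrite (_ : 2%:C = 1 + 1) ?rmorphD ?rmorph1 // scalerDl !scale1r opprD /A.
    by rewrite !addrA [in RHS]addrAC [X in _ = X - _]addrAC [X in _ = X - _ - _]addrAC subrK.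
  by rewrite e subrr add0r.
by rewrite scalerA -rmorphM mulfV ?gt_eqF // scale1r.
Qed.

(** * The polar decomposition *)

Section Polar.
Variable T : H -> H.
Hypothesis bT : bounded_operator T.
Let lT : linear T := proj1 bT.
Local Notation absT := (modulus ip T).

Lemma gram_positive : positive_operator ip (adjoint ip T \o T).
Proof.
have [bA _] := adjointP T bT.
apply: positive_operator_re => [|x y|x]; first exact: bounded_comp.
  by rewrite /= reC -!re_adjoint // reC.
by rewrite /= reC -re_adjoint // nrE sqr_ge0.
Qed.

Lemma modulus_positive : positive_operator ip absT.
Proof. by have [] := op_sqrtP _ gram_positive. Qed.

(** |T| is symmetric with square T^* T; thus |T|z and Tz have equal norms. *)
Lemma modulus_re x y : re (absT x) (absT y) = re (T x) (T y).
Proof.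
rewrite (positive_re_sym _ _ modulus_positive) (re_adjoint _ _ _ bT).
by rewrite -[absT (absT y)]/((absT \o absT) y) (op_sqrtP _ gram_positive).2.
Qed.

Lemma nr_modulus x : nr (absT x) = nr (T x).
Proof. by apply/eqP; rewrite -(@eqrXn2 _ 2) ?nr_ge0 // -!nrE modulus_re. Qed.

Lemma modulus_linear : linear absT.
Proof. by have [[]] := modulus_positive. Qed.

Lemma modulus_eq0 x : absT x = 0 <-> T x = 0.
Proof. by split=> h; apply: nr_eq0; rewrite -?nr_modulus ?h ?nr0 // nr_modulus h nr0. Qed.

(* The polar part is built as the adjoint of the operator V determined by
   <Tz, y> = <|T|z, Vy> with Vy in the closure of the range of |T|. *)
Lemma polar_partP : [/\ partial_isometry ip (polar_part ip T),
  nullspace (polar_part ip T) = nullspace T & T = polar_part ip T \o absT].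
Proof.
suff /getPex : exists U, [set U : H -> H | [/\ partial_isometry ip U,
  nullspace U = nullspace T & T = U \o absT]] U by [].
have lP := modulus_linear.
have [V hV] : {V : H -> H & forall y, range_closure absT (V y) /\
    forall z, re (T z) y = re (absT z) (V y)}.
  apply: (@choice _ _ (fun y v => range_closure absT v /\
    forall z, re (T z) y = re (absT z) v)) => y.
  have [|||x|v v1 v2] := @riesz_range absT (fun z => re (T z) y) (nr y); last by exists v.
  - exact: lP.
  - by move=> x z; rewrite (linear_D lT) reDl.
  - by move=> a x; rewrite (linear_Z lT) reZl.
  by rewrite nr_modulus mulrC; apply: re_cs.
(* Two candidates differ by a vector of the closure that is orthogonal to the range, hence to
   itself. Linearity of V and V(Tz) = |T|z follow from this uniqueness. *)
have V_uniq v y : range_closure absT v -> (forall z, re (T z) y = re (absT z) v) -> v = V y.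
  move=> clv hv; apply/subr0_eq; apply: nr_eq0; apply/eqP; rewrite -sqrf_eq0 -nrE; apply/eqP.
  have orth z : re (absT z) (v - V y) = 0 by rewrite reBr -hv (hV y).2 subrr.
  by rewrite reBl !(range_closure_orth absT _ _ _ orth) ?subrr //; case: (hV y).
have lV : linear V.
  move=> a x y; apply/esym/V_uniq.
    by apply: range_closure_linear; [exact: lP | case: (hV x) | case: (hV y)].
  by move=> z; rewrite !reDr !re_conj -(linear_Z lT) -(linear_Z lP) (hV x).2 (hV y).2.
(* For |T|z near Vy, |Vy|^2 is near <|T|z, Vy> = <Tz, y>, which is at most |Tz| |y| = | |T|z |
   |y|. *)
have cV y : nr (V y) <= nr y.
  apply: nr_le_of_sqr; first exact: nr_ge0.
  rewrite -nrE -subr_le0; apply: (@le0_of_le_eps _ (nr (V y) + nr y)) => e e0.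
  have [z /ltW hz] := (hV y).1 _ e0.
  have := re_cs (V y - absT z) (V y); have := re_cs (T z) y.
  rewrite (hV y).2 -nr_modulus.
  have := nrD (absT z - V y) (V y); rewrite subrK (nrB _ (V y)) reBl.
  have := ler_wpM2r (nr_ge0 (V y)) hz; have := ler_wpM2r (nr_ge0 y) hz.
  by have := nr_ge0 y; nra.
have bV : bounded_operator V.
  by apply/bounded_operatorP; split=> //; exists 1 => // x; rewrite mul1r.
have VT z : V (T z) = absT z.
  by apply/esym/V_uniq => [|w]; [exact: range_closure_range | rewrite modulus_re].
pose U := adjoint ip V.
have [bU _] := adjointP V bV; have hU x y : re (V x) y = re x (U y) by apply: re_adjoint.
have UT z : U (absT z) = T z.
  by apply: re_inj => y; rewrite -hU reC -(hV y).2 reC.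
have lU : linear U by case: bU.
(* Both sides say that x is orthogonal to the range of |T|. *)
have nullU x : U x = 0 <-> T x = 0.
  rewrite -modulus_eq0; split=> h.
    apply: re_inj => z; rewrite (reC z 0) re0l -(positive_re_sym _ _ modulus_positive).
    by rewrite -VT hU h reC re0l.
  have orth z : re (absT z) x = 0.
    by rewrite (positive_re_sym _ _ modulus_positive) h reC re0l.
  apply: re_inj => z; rewrite -hU (reC z 0) re0l.
  by apply: range_closure_orth orth; case: (hV z).
exists U; split; last by apply/funext => z /=; rewrite UT.
- split=> // x x_orth.
  have [|||z|v clv hv] := @riesz_range absT (fun z => re (absT z) x) (nr x).
  + exact: lP.
  + by move=> y z; rewrite (linear_D lP) reDl.
  + by move=> a y; rewrite (linear_Z lP) reZl.
  + by rewrite mulrC; apply: re_cs.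
  (* v is the projection of x on the closure of the range of |T|; x - v lies in the null space of U,
     so it is orthogonal to x as well as to v. *)
  have xv : x = v.
    have orth z : re (absT z) (x - v) = 0 by rewrite reBr hv subrr.
    apply/subr0_eq; apply: nr_eq0; apply/eqP; rewrite -sqrf_eq0 -nrE reBl.
    rewrite (range_closure_orth _ _ _ clv orth) subr0 /re x_orth //.
    apply/nullU/modulus_eq0; apply: re_inj => z; rewrite (reC z 0) re0l.
    by rewrite -(positive_re_sym _ _ modulus_positive) orth.
  have cU y : nr (U y) <= nr y.
    apply: nr_le_of_sqr; first exact: nr_ge0.
    rewrite -nrE -hU; apply: (le_trans (re_cs _ _)); apply: ler_wpM2r; [exact: nr_ge0|].
    exact: cV.
  suff e : nr (U x) = nr x by rewrite !normE e.
  (* U preserves the norm of each |T|z, and x is a limit of such vectors. *)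
  apply/eqP; rewrite eq_le cU /= -subr_le0; apply: (@le0_of_le_eps _ 2) => e e0.
  rewrite -xv in clv; have [z /ltW hz] := clv _ e0.
  have := nrD (x - absT z) (absT z); rewrite subrK nr_modulus -UT.
  have := nrD (U (absT z - x)) (U x); rewrite -(linear_D lU) subrK.
  have := cU (absT z - x); rewrite (nrB _ x); lra.
by apply/seteqP; split=> x /= /nullU.
Qed.

Lemma polar_part_bounded : bounded_operator (polar_part ip T).
Proof. by have [[]] := polar_partP. Qed.

(** Project x to v in the closure of the range of U^*. Then Ux = Uv, and v is orthogonal to the null
    space, so |Ux| = |v| <= |x|. *)
Lemma nr_partial_isometry_le (U : H -> H) x : partial_isometry ip U -> nr (U x) <= nr x.
Proof.
move=> [bU hU]; have [lU _] := bU.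
have [bA _] := adjointP U bU; have lA : linear (adjoint ip U) by case: bA.
have [|||z|v clv hv] := @riesz_range (adjoint ip U) (fun z => re (adjoint ip U z) x) (nr x).
- exact: lA.
- by move=> y z; rewrite (linear_D lA) reDl.
- by move=> a y; rewrite (linear_Z lA) reZl.
- by rewrite mulrC; apply: re_cs.
have -> : U x = U v.
  by apply: re_inj => z; rewrite ![re z _]reC !re_adjoint // ![re _ (adjoint _ _ _)]reC.
have -> : nr (U v) = nr v.
  rewrite /nr hU // => y; rewrite /nullspace /= => Uy.
  have orth w : U w = 0 -> re v w = 0.
    move=> Uw; apply: (range_closure_orth _ _ _ clv) => z.
    by rewrite reC -re_adjoint // Uw re0l.
  rewrite -[RHS](linear0l ip 0); apply: ip_eq; rewrite re0l orth //.
  by rewrite (linear_Z lU) Uy scaler0.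
apply: nr_le_of_sqr; first exact: nr_ge0.
have : re v (x - v) = 0.
  by apply: (range_closure_orth _ _ _ clv) => z; rewrite reBr hv subrr.
by rewrite reBr nrE => /subr0_eq <-; apply: re_cs.
Qed.
End Polar.

(** * The operator norm *)

Section OperatorNorm.
Variable S : H -> H.
Hypothesis bS : bounded_operator S.
Let lS : linear S := proj1 bS.

Let unit_ballE x : (`|x| <= 1) = (nr x <= 1).
Proof. by rewrite normE -(lecR _ 1). Qed.

Lemma opnorm_has_sup : has_sup [set complex.Re `|S x| | x in [set x : H | `|x| <= 1]].
Proof.
split; first by exists (nr (S 0)); exists 0 => //=; rewrite normr0.
have [_ [m m0 hm]] := iffLR (bounded_operatorP S) bS; exists m => _ [x /= x1 <-].
by apply: (le_trans (hm x)); rewrite ger_pMr // -unit_ballE.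
Qed.

Lemma nr_le_opnorm x : nr (S x) <= opnorm S * nr x.
Proof.
have [x0|x0] := eqVneq (nr x) 0; first by rewrite (nr_eq0 _ x0) (linear_0 lS) nr0 mulr0.
have x1 : 0 < nr x by rewrite lt0r x0 nr_ge0.
rewrite -ler_pdivrMr // mulrC; have i0 : 0 <= (nr x)^-1 by rewrite invr_ge0 nr_ge0.
rewrite -(ger0_norm i0) -nrZ -(linear_Z lS).
apply: ub_le_sup; first by case: opnorm_has_sup.
by exists ((nr x)^-1%:C *: x) => //=; rewrite unit_ballE nrZ ger0_norm // mulVf.
Qed.

Lemma opnorm_ge0 : 0 <= opnorm S.
Proof.
apply: (le_trans (nr_ge0 (S 0))); apply: ub_le_sup; first by case: opnorm_has_sup.
by exists 0 => //=; rewrite normr0.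
Qed.

Lemma opnorm_le (c : R) : (forall x, nr x <= 1 -> nr (S x) <= c) -> opnorm S <= c.
Proof.
move=> h; apply: ge_sup; first by case: opnorm_has_sup.
by move=> _ [x /= x1 <-]; apply: h; rewrite -unit_ballE.
Qed.

(** Passes from the ball of [opnorm] to the sphere of the numerical range: normalising a nonzero x
    of the ball does not decrease |Sx|. If x = 0, then [opnorm S - e] is negative and any unit
    vector serves. *)
Lemma opnorm_approx_unit (e : R) : (exists x : H, x != 0) -> 0 < e ->
  exists2 x, nr x = 1 & opnorm S - e < nr (S x).
Proof.
move=> [y y0] e0.
have normalize z : z != 0 -> nr ((nr z)^-1%:C *: z) = 1.
  move=> z0; rewrite nrZ ger0_norm ?invr_ge0 ?nr_ge0 // mulVf //.
  by apply: contra_neq z0; apply: nr_eq0.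
have [_ [x /= x1 <-] hx] := sup_adherent e0 opnorm_has_sup.
have [x0|x0] := eqVneq x 0.
  exists ((nr y)^-1%:C *: y); first exact: normalize.
  by apply: (lt_le_trans hx); rewrite x0 (linear_0 lS) normr0 nr_ge0.
exists ((nr x)^-1%:C *: x); first exact: normalize.
apply: (lt_le_trans hx); rewrite (linear_Z lS) nrZ ger0_norm ?invr_ge0 ?nr_ge0 //.
apply: ler_peMl; first exact: nr_ge0.
by rewrite invf_ge1 -?unit_ballE // lt0r nr_ge0 andbT; apply: contra_neq x0; apply: nr_eq0.
Qed.
End OperatorNorm.

(** * Norm bounds for the transforms *)

Section Transforms.
Variable T : H -> H.
Hypothesis bT : bounded_operator T.

Let isoU := let: And3 h _ _ := polar_partP T bT in h.

Lemma nr_duggal_le x : nr (duggal ip T x) <= opnorm T * nr x.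
Proof.
rewrite /duggal /= nr_modulus //; apply: (le_trans (nr_le_opnorm T bT _)).
by rewrite ler_wpM2l ?opnorm_ge0 // nr_partial_isometry_le.
Qed.

(** The square of the left side is <|T|x, x>, at most |Tx| |x|. *)
Lemma nr_sqrt_modulus_le x : nr (op_sqrt ip (modulus ip T) x) <= Num.sqrt (opnorm T) * nr x.
Proof.
have [pQ QQ] := op_sqrtP _ (modulus_positive T bT).
rewrite -(@ler_pXn2r _ 2) ?nnegrE ?mulr_ge0 ?sqrtr_ge0 ?nr_ge0 //.
rewrite exprMn sqr_sqrtr ?opnorm_ge0 // -nrE (positive_re_sym _ _ pQ).
rewrite -[op_sqrt ip _ (op_sqrt ip _ x)]/((op_sqrt ip _ \o op_sqrt ip _) x) QQ reC.
apply: (le_trans (re_cs _ _)); rewrite expr2 mulrA ler_wpM2r ?nr_ge0 //.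
by rewrite nr_modulus // nr_le_opnorm.
Qed.

Lemma nr_aluthge_le x : nr (aluthge ip T x) <= opnorm T * nr x.
Proof.
rewrite /aluthge /=; apply: (le_trans (nr_sqrt_modulus_le _)).
rewrite -[X in X * nr x](sqr_sqrtr (opnorm_ge0 T bT)) expr2 -mulrA.
rewrite ler_wpM2l ?sqrtr_ge0 //; apply: le_trans (nr_sqrt_modulus_le _).
exact: nr_partial_isometry_le.
Qed.

Lemma duggal_bounded : bounded_operator (duggal ip T).
Proof.
by apply: bounded_comp; [case: (modulus_positive T bT) | apply: polar_part_bounded].
Qed.

Lemma aluthge_bounded : bounded_operator (aluthge ip T).
Proof.
have [[bQ _] _] := op_sqrtP _ (modulus_positive T bT).
by do 2?apply: bounded_comp => //; apply: polar_part_bounded.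
Qed.

Lemma mean_transform_bounded t : bounded_operator (mean_transform ip t T).
Proof. by apply: bounded_scaleD => //; apply: duggal_bounded. Qed.

Lemma nr_mean_transform_le t x : 0 <= t <= 1 ->
  nr (mean_transform ip t T x) <= opnorm T * nr x.
Proof.
move=> /andP[t0 t1]; rewrite /mean_transform !fctE /=.
apply: (le_trans (nrD _ _)); rewrite !nrZ !ger0_norm ?subr_ge0 //.
by have := nr_le_opnorm T bT x; have := nr_duggal_le x; nra.
Qed.

(** The weight of the Aluthge transform is 2 lam (1 - lam) = 1 - c. *)
Lemma power_mean_transformE (lam : R) : let c := (1 - lam) ^+ 2 + lam ^+ 2 in c != 0 ->
  power_mean_transform ip lam T =
  c%:C *: mean_transform ip ((1 - lam) ^+ 2 / c) T + (1 - c)%:C *: aluthge ip T.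
Proof.
move=> c c0; rewrite /power_mean_transform /mean_transform scalerDr !scalerA -!rmorphM.
congr (_%:C *: _ + _%:C *: _ + _%:C *: _).
- by rewrite mulrC divfK.
- by rewrite mulrBr mulr1 [c * _]mulrC divfK // /c addrAC subrr add0r.
- by rewrite /c; ring.
Qed.
End Transforms.

(* For a proper convex combination P = c M + (1 - c) D of operators of norm at
   most N, |Px| is close to N exactly when Re <Dx, Mx> is close to N^2. *)
Section ConvexCombination.
Variables (M D : H -> H) (c N : R).
Hypotheses (bM : bounded_operator M) (bD : bounded_operator D).
Hypotheses (c01 : 0 < c < 1) (N0 : 0 <= N).
Hypotheses (cM : forall x, nr (M x) <= N * nr x) (cD : forall x, nr (D x) <= N * nr x).
Local Notation P := (c%:C *: M + (1 - c)%:C *: D).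

Lemma nr_convexE x : nr (P x) ^+ 2 = c ^+ 2 * nr (M x) ^+ 2
  + (1 - c) ^+ 2 * nr (D x) ^+ 2 + 2 * c * (1 - c) * re (D x) (M x).
Proof. by rewrite -nrE !fctE /= !reE (reC (M x)) !nrE; ring. Qed.

Lemma nr_le_at_unit x : nr x = 1 -> nr (M x) <= N /\ nr (D x) <= N.
Proof. by move=> x1; have := cM x; have := cD x; rewrite x1 mulr1. Qed.

(** The value is <Dx, Mx>, with both parts written through [re] so that the real estimates apply. *)
Lemma numerical_rangeE x :
  ip ((adjoint ip M \o D) x) x = Complex (re (D x) (M x)) (- re (M x) ('i *: D x)).
Proof.
have [_ h] := adjointP M bM.
rewrite /= hermC /= expr0 mul1r -h (reC (D x)) reIr /re.
by case: (ip (M x) (D x)).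
Qed.

Lemma opnorm_convex_le : opnorm P <= N.
Proof.
apply: opnorm_le; first exact: bounded_scaleD.
move=> x x1; rewrite !fctE /=; apply: (le_trans (nrD _ _)).
case/andP: c01 => c0 c1; rewrite !nrZ !ger0_norm ?subr_ge0 ?(ltW c0) ?(ltW c1) //.
have xN : N * nr x <= N by rewrite ler_piMr.
have d0 : 0 <= 1 - c by lra.
have := ler_wpM2l (ltW c0) (le_trans (cM x) xN).
by have := ler_wpM2l d0 (le_trans (cD x) xN); lra.
Qed.

Lemma opnorm_convex_eqP : (exists x : H, x != 0) ->
  opnorm P = N <->
  closure (numerical_range ip (adjoint ip M \o D)) ((N ^+ 2)%:C : R[i]^o).
Proof.
move=> Hn0; case/andP: (c01) => c0 c1.
have c2 : 0 < c * (1 - c) by rewrite mulr_gt0 // subr_gt0.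
have bP : bounded_operator P by apply: bounded_scaleD.
split=> [eN B /nbhs_ballP[e /= e0 eB]|clN].
  have ee : e = (complex.Re e)%:C by rewrite [LHS]complexE (ger0_Im (ltW e0)) mulr0 addr0.
  move: (complex.Re e) ee => r ee; rewrite {}ee in e0 eB; rewrite ltcR in e0.
  have r2 : 0 < r ^+ 2 by rewrite exprn_gt0.
  have N2 : 0 <= N ^+ 2 by rewrite sqr_ge0.
  (* Chosen so that d <= 1 and d^2 + 2 d N^2 <= d (1 + 2 N^2) < r^2. *)
  pose d := r ^+ 2 / (2 * (1 + 2 * N ^+ 2 + r ^+ 2)).
  have d0 : 0 < d by rewrite divr_gt0 //; lra.
  have dE : d * (2 * (1 + 2 * N ^+ 2 + r ^+ 2)) = r ^+ 2 by rewrite divfK // gt_eqF //; lra.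
  (* A loss of 2 N eta in |Px|^2 costs N eta / (c (1 - c)) <= d in Re <Dx, Mx>; N + 1 covers N =
     0. *)
  pose eta := d * (c * (1 - c)) / (N + 1).
  have N1 : 0 < N + 1 by rewrite ltr_wpDl.
  have eta0 : 0 < eta by rewrite divr_gt0 // mulr_gt0.
  have etaE : eta * (N + 1) = d * (c * (1 - c)) by rewrite divfK // gt_eqF.
  have [x x1] := opnorm_approx_unit P bP _ Hn0 eta0; rewrite eN => hx.
  have [hM hD] := nr_le_at_unit _ x1.
  have hP : N ^+ 2 - 2 * (N * eta) <= nr (P x) ^+ 2.
    have : nr (P x) <= N by rewrite -eN; have := nr_le_opnorm P bP x; rewrite x1 mulr1.
    by have := nr_ge0 (P x); nra.
  have M2 : nr (M x) ^+ 2 <= N ^+ 2 by have := nr_ge0 (M x); nra.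
  have D2 : nr (D x) ^+ 2 <= N ^+ 2 by have := nr_ge0 (D x); nra.
  have delta : N ^+ 2 - re (D x) (M x) <= d.
    rewrite -(ler_pM2r c2); move: hP; rewrite nr_convexE => hP.
    have := ler_wpM2l (sqr_ge0 c) M2; have := ler_wpM2l (sqr_ge0 (1 - c)) D2; lra.
  have delta0 : 0 <= N ^+ 2 - re (D x) (M x).
    by have := re_cs (D x) (M x); have := nr_ge0 (M x); have := nr_ge0 (D x); nra.
  exists (ip ((adjoint ip M \o D) x) x); split.
    by exists x => //=; rewrite normE x1.
  apply: eB; rewrite -ball_normE /ball_ /= -[ip _ _]/(ip ((adjoint ip M \o D) x) x).
  rewrite numerical_rangeE normc_def /= ltcR sub0r opprK.
  set a := re (D x) (M x) in delta delta0 *; set b := re (M x) _.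
  (* <Mx, Mx> is real, so Dx may be replaced by Dx - Mx in b, and |Dx - Mx|^2 <= 2 N^2 - 2a <=
     2d. *)
  have hb : b ^+ 2 <= 2 * d * N ^+ 2.
    have diff : nr (D x - M x) ^+ 2 <= 2 * d.
      by rewrite -nrE !reE (reC (M x)) -/a !nrE; lra.
    have bE : b = re (M x) ('i *: (D x - M x)).
      by rewrite scalerBr !reE [re (M x) ('i *: M x)]reIr -norm_ip normE -rmorphXn /= subr0.
    have hb1 : b <= nr (M x) * nr (D x - M x) by rewrite bE -[nr (D x - M x)]nrI re_cs.
    have hb2 : - b <= nr (M x) * nr (D x - M x).
      by rewrite bE -reNl -[nr (D x - M x)]nrI -(nrN (M x)) re_cs.
    have hb3 : b ^+ 2 <= (nr (M x) * nr (D x - M x)) ^+ 2.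
      have : 0 <= nr (M x) * nr (D x - M x) by rewrite mulr_ge0 ?nr_ge0.
      nra.
    apply: (le_trans hb3); rewrite exprMn mulrC.
    by apply: ler_pM; rewrite ?sqr_ge0.
  rewrite -(@ltr_pXn2r _ 2) ?nnegrE ?sqrtr_ge0 ?(ltW e0) // sqr_sqrtr; last first.
    by rewrite addr_ge0 ?sqr_ge0.
  have d1 : d <= 1.
    by rewrite -(@ler_pM2r _ (2 * (1 + 2 * N ^+ 2 + r ^+ 2))) ?dE; lra.
  have : (N ^+ 2 - a) ^+ 2 <= d ^+ 2 by rewrite ler_pXn2r ?nnegrE ?(ltW d0).
  have : d ^+ 2 <= d by rewrite expr2 ger_pMr.
  have : 0 < d * r ^+ 2 by rewrite mulr_gt0.
  by have := mulr_ge0 (ltW d0) N2; move: hb d0 dE; rewrite -/b; lra.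
apply/eqP; rewrite eq_le opnorm_convex_le /=.
rewrite -(@ler_pXn2r _ 2) ?nnegrE ?opnorm_ge0 // -subr_le0.
(* If Re <Dx, Mx> > N^2 - e, then |Dx|^2 and |Mx|^2 are at least N^2 - 2e, hence so is their
   weighted combination |Px|^2. *)
apply: (@le0_of_le_eps _ 2) => e e0.
have [|z [[x x1 <-]]] := clN (ball ((N ^+ 2)%:C : R[i]^o) e%:C).
  by apply: nbhsx_ballx; rewrite ltcR.
rewrite -ball_normE /ball_ /= -[ip _ _]/(ip ((adjoint ip M \o D) x) x) numerical_rangeE.
move: x1; rewrite /= normE => /complexI x1.
have [hM hD] := nr_le_at_unit _ x1.
move=> /(le_lt_trans (normc_ge_Re _)); rewrite /= ltcR => /(le_lt_trans (ler_norm _)) hre.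
have hP : nr (P x) <= opnorm P by have := nr_le_opnorm P bP x; rewrite x1 mulr1.
have hP2 : nr (P x) ^+ 2 <= opnorm P ^+ 2 by rewrite ler_pXn2r ?nnegrE ?nr_ge0 ?opnorm_ge0.
have M2 : nr (M x) ^+ 2 <= N ^+ 2 by have := nr_ge0 (M x); nra.
have D2 : nr (D x) ^+ 2 <= N ^+ 2 by have := nr_ge0 (D x); nra.
have : 2 * re (D x) (M x) <= nr (D x) ^+ 2 + nr (M x) ^+ 2.
  by have := sqr_ge0 (nr (D x - M x)); rewrite -(nrE (D x - M x)) !reE (reC (M x)) !nrE; lra.
move=> h.
have M3 : N ^+ 2 - 2 * e <= nr (M x) ^+ 2 by lra.
have D3 : N ^+ 2 - 2 * e <= nr (D x) ^+ 2 by lra.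
have := ler_wpM2l (sqr_ge0 c) M3; have := ler_wpM2l (sqr_ge0 (1 - c)) D3.
have := ler_wpM2l (ltW c2) (ltW hre); have := mulr_gt0 c2 e0.
move: hP2; rewrite nr_convexE; lra.
Qed.
End ConvexCombination.
End RealInnerProduct.

(** * The equivalence for the power mean transform *)

Theorem corollary2p22
  (R : realType)
  (H : completeNormedModType R[i])
  (ip : {dot H for Num.conj})
  (norm_ip : forall x : H, `|x| ^+ 2 = ip x x)
  (H_nonzero : exists x : H, x != 0)
  (lam : R) (lam01 : 0 < lam < 1)
  (T : H -> H) (T_bounded : bounded_operator T) :
  opnorm (power_mean_transform ip lam T) = opnorm T <->
  closure
    (numerical_range ip
      (adjoint ip
         (mean_transform ip
            ((1 - lam) ^+ 2 / ((1 - lam) ^+ 2 + lam ^+ 2)) T)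
       \o aluthge ip T))
    ((opnorm T ^+ 2)%:C : R[i]^o).
Proof.
case/andP: lam01 => l0 l1.
set c := (1 - lam) ^+ 2 + lam ^+ 2.
(* c = 1 - 2 lam (1 - lam) lies strictly between 0 and 1, so the convex combination is proper. *)
have c0 : 0 < c by rewrite /c; nra.
have c1 : c < 1 by rewrite /c; nra.
rewrite power_mean_transformE ?gt_eqF // -/c.
apply: opnorm_convex_eqP => //.
- exact: mean_transform_bounded.
- exact: aluthge_bounded.
- by rewrite c0.
- exact: opnorm_ge0.
- move=> x; apply: nr_mean_transform_le => //.
  rewrite divr_ge0 ?sqr_ge0 ?(ltW c0) //= ler_pdivrMr // mul1r.
  by rewrite lerDl sqr_ge0.
exact: nr_aluthge_le.
Qed.
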